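(* Let $L$ be any fragment of first-order logic such that (1) every self-guarded $\mathrm{GFO}$-formula is equivalent to a formula of $L$; (2) $L$ is closed under self-guarded substitution; (3) $L$ is closed under conjunction and disjunction; and (4) $L$ has the Craig interpolation property. Then every $\mathrm{GNFO}$-formula (not only sentences or self-guarded formulas) is equivalent to a formula of $L$.
   Context: All signatures are relational (no constant or function symbols). An FO-fragment $L$ is a set of first-order formulas; a formula is expressible in $L$ if it is logically equivalent to some formula of $L$. A guard for a formula $\varphi$ is an atomic formula $\alpha$ (possibly an equality) whose free variables include all free variables of $\varphi$. An $\exists$-guard for $\varphi$ is a formula $\exists\overline{x}\beta$ with $\beta$ atomic (possibly an equality) whose free variables include all free variables of $\varphi$. The guarded fragment $\mathrm{GFO}$ is generated by $\varphi ::= \top \mid R(\overline{x}) \mid x=y \mid \lnot\varphi \mid \varphi\land\psi \mid \exists\overline{x}(\alpha\land\varphi)$, where $\alpha$ is a guard for $\varphi$. The guarded-negation fragment $\mathrm{GNFO}$ is generated by $\varphi ::= \top \mid R(\overline{x}) \mid x=y \mid \varphi\lor\varphi \mid \varphi\land\varphi \mid \exists x\varphi \mid \alpha\land\lnot\varphi$, where $\alpha$ is a guard for $\varphi$. A first-order formula is self-guarded if it is a sentence or of the form $\alpha\land\varphi$ with $\alpha$ an $\exists$-guard for $\varphi$. $L$ is closed under self-guarded substitution if for every $\varphi\in L$ containing an $n$-ary relation symbol $R$ and every self-guarded $\psi(x_1,\dots,x_n)\in L$, the formula obtained from $\varphi$ by replacing every subformula $R(y_1,\dots,y_n)$ by $\psi(y_1,\dots,y_n)$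 (safe substitution) is expressible in $L$. $L$ is closed under conjunction and disjunction if for all $\varphi,\psi\in L$, both $\varphi\land\psi$ and $\varphi\lor\psi$ are expressible in $L$. $L$ has the Craig interpolation property if whenever $\varphi,\psi\in L$ and $\varphi\models\psi$, there is $\vartheta\in L$ with $\varphi\models\vartheta\models\psi$ such that every non-logical symbol of $\vartheta$ occurs in both $\varphi$ and $\psi$.
   Formalization: ''Equivalent to/expressible in L'' also requires the L-formula to use only relation symbols of the given formula (with bare equivalence the claim fails for padded GFO), and in (2) the self-guarded ψ need only be expressible in L, not a member. *)

(* Defs.v *)
From mathcomp Require Import all_boot.

Set Implicit Arguments.
Unset Strict Implicit.
Unset Printing Implicit Defensive.

(* A relation symbol is a pair (name, arity), so the vocabulary has countably
   many symbols of every arity, nullary ones included. *)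
Notation rsym := (nat * nat)%type.
Definition arity (R : rsym) : nat := R.2.

Notation var := nat (only parsing).

(* Universal quantification and implication are the usual abbreviations. *)
Inductive formula : Type :=
  | Top
  | Atom (R : rsym) (xs : (arity R).-tuple var)
  | Eq (x y : var)
  | Not (phi : formula)
  | And (phi psi : formula)
  | Or (phi psi : formula)
  | Ex (x : var) (phi : formula).

Definition exs (xs : seq var) (phi : formula) : formula := foldr Ex phi xs.

Fixpoint fv (phi : formula) : seq var :=
  match phi with
  | Top => [::]
  | Atom R xs => xs
  | Eq x y => [:: x; y]
  | Not phi => fv phi
  | And phi psi | Or phi psi => fv phi ++ fv psi
  | Ex x phi => [seq y <- fv phi | y != x]
  end.

Fixpoint syms (phi : formula) : seq rsym :=
  match phi with
  | Top | Eq _ _ => [::]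
  | Atom R _ => [:: R]
  | Not phi | Ex _ phi => syms phi
  | And phi psi | Or phi psi => syms phi ++ syms psi
  end.

(* Domains are nonempty in effect: satisfaction is relative to an assignment
   [var -> dom M]. *)
Record structure : Type := Structure {
  dom : Type;
  interp : forall R : rsym, (arity R).-tuple dom -> Prop
}.

Definition update (D : Type) (v : var -> D) (x : var) (a : D) : var -> D :=
  fun y => if y == x then a else v y.

Fixpoint sat (M : structure) (v : var -> dom M) (phi : formula) : Prop :=
  match phi with
  | Top => True
  | Atom R xs => interp (map_tuple v xs)
  | Eq x y => v x = v y
  | Not phi => ~ sat v phi
  | And phi psi => sat v phi /\ sat v psi
  | Or phi psi => sat v phi \/ sat v psi
  | Ex x phi => exists a : dom M, sat (update v x a) phi
  end.

Definition entails (phi psi : formula) : Prop :=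
  forall (M : structure) (v : var -> dom M), sat v phi -> sat v psi.

Definition equivalent (phi psi : formula) : Prop :=
  forall (M : structure) (v : var -> dom M), sat v phi <-> sat v psi.

Definition atomic (phi : formula) : bool :=
  match phi with Atom _ _ | Eq _ _ => true | _ => false end.

Definition guard (alpha phi : formula) : Prop :=
  atomic alpha /\ {subset fv phi <= fv alpha}.

Definition ex_guard (gamma phi : formula) : Prop :=
  exists (xs : seq var) (beta : formula),
    [/\ gamma = exs xs beta, atomic beta & {subset fv phi <= fv gamma}].

Inductive GFO : formula -> Prop :=
  | GFO_top : GFO Top
  | GFO_atom (R : rsym) (xs : (arity R).-tuple var) : GFO (Atom xs)
  | GFO_eq (x y : var) : GFO (Eq x y)
  | GFO_not (phi : formula) : GFO phi -> GFO (Not phi)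
  | GFO_and (phi psi : formula) : GFO phi -> GFO psi -> GFO (And phi psi)
  | GFO_ex (xs : seq var) (alpha phi : formula) :
      guard alpha phi -> GFO phi -> GFO (exs xs (And alpha phi)).

Inductive GNFO : formula -> Prop :=
  | GNFO_top : GNFO Top
  | GNFO_atom (R : rsym) (xs : (arity R).-tuple var) : GNFO (Atom xs)
  | GNFO_eq (x y : var) : GNFO (Eq x y)
  | GNFO_or (phi psi : formula) : GNFO phi -> GNFO psi -> GNFO (Or phi psi)
  | GNFO_and (phi psi : formula) : GNFO phi -> GNFO psi -> GNFO (And phi psi)
  | GNFO_ex (x : var) (phi : formula) : GNFO phi -> GNFO (Ex x phi)
  | GNFO_gneg (alpha phi : formula) :
      guard alpha phi -> GNFO phi -> GNFO (And alpha (Not phi)).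

Definition self_guarded (phi : formula) : Prop :=
  fv phi = [::] \/
  exists gamma chi : formula, phi = And gamma chi /\ ex_guard gamma chi.

Definition fresh (s : seq var) : var := (foldr maxn 0 s).+1.

(* Capture-avoiding simultaneous substitution of the variable [f x] for every
   free variable [x]; bound variables are always renamed apart. *)
Fixpoint rename (f : var -> var) (phi : formula) : formula :=
  match phi with
  | Top => Top
  | Atom R xs => Atom (map_tuple f xs)
  | Eq x y => Eq (f x) (f y)
  | Not phi => Not (rename f phi)
  | And phi psi => And (rename f phi) (rename f psi)
  | Or phi psi => Or (rename f phi) (rename f psi)
  | Ex x phi =>
      let z := fresh [seq f y | y <- fv (Ex x phi)] in
      Ex z (rename (update f x z) phi)
  end.

(* [inst xs ys psi] is psi(y_1, ..., y_n) for psi = psi(x_1, ..., x_n). *)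
Definition inst (xs ys : seq var) (psi : formula) : formula :=
  rename (fun x => nth x ys (index x xs)) psi.

(* Replaces every R(y_1, ..., y_n) in the last argument by psi(y_1, ..., y_n).
   When the free variables of psi are among [xs], those of the inserted formula
   are among the y_i, so the quantifiers of the host formula capture exactly
   what they bound before. *)
Fixpoint replace (R : rsym) (xs : seq var) (psi phi : formula) : formula :=
  match phi with
  | Top => Top
  | Atom Q ys => if Q == R then inst xs ys psi else Atom ys
  | Eq x y => Eq x y
  | Not phi => Not (replace R xs psi phi)
  | And phi1 phi2 => And (replace R xs psi phi1) (replace R xs psi phi2)
  | Or phi1 phi2 => Or (replace R xs psi phi1) (replace R xs psi phi2)
  | Ex x phi => Ex x (replace R xs psi phi)
  end.

(* Equivalence to a formula of L is understood over the signature of the given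
   formula: the witness in L may not use further relation symbols.  Without
   this, padding every formula with tautologies over many irrelevant symbols
   would make Craig interpolation hold trivially. *)
Definition expressible (L : formula -> Prop) (phi : formula) : Prop :=
  exists psi : formula,
    [/\ L psi, equivalent phi psi & {subset syms psi <= syms phi}].

(* The notation psi(x_1, ..., x_n) means that x_1, ..., x_n are pairwise
   distinct and are exactly the free variables of psi; if some x_i were not
   free in psi, replacing a guard R(y_1, ..., y_n) by psi would destroy
   guardedness.  Self-guardedness is a syntactic property whereas fragments
   matter only up to equivalence, so psi itself need only be expressible in L. *)
Definition closed_under_sg_substitution (L : formula -> Prop) : Prop :=
  forall (phi : formula) (R : rsym) (xs : (arity R).-tuple var)
         (psi : formula),
    L phi -> R \in syms phi ->
    expressible L psi -> self_guarded psi ->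
    uniq xs -> fv psi =i xs ->
    expressible L (replace R xs psi phi).

Definition closed_under_and_or (L : formula -> Prop) : Prop :=
  forall phi psi : formula, L phi -> L psi ->
    expressible L (And phi psi) /\ expressible L (Or phi psi).

Definition craig_interpolation (L : formula -> Prop) : Prop :=
  forall phi psi : formula, L phi -> L psi -> entails phi psi ->
    exists theta : formula,
      [/\ L theta, entails phi theta, entails theta psi,
          {subset syms theta <= syms phi} & {subset syms theta <= syms psi}].

(* Main.v *)
(* By guarded substitution, everything reduces to showing that L expresses every
   formula [exists ys, chi] with [chi] a conjunction of guarded formulas.  Let
   [us] be its free variables.  Craig interpolation between
   [G'(us) /\ exists ys, (G /\ chi)], with fresh guards [G] and [G'], and
   [\/_u ~ P_u(u) \/ exists ys, chi^P], where [chi^P] quantifies [us] away in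
   each conjunct of [chi] separately while demanding [P_u(u)], yields a formula
   equivalent to [exists ys, chi]: the left-hand side allows any witnesses when
   the guards are full relations, and the right-hand side is exact when each
   [P_u] is a singleton.  Now [chi^P] has no free variables outside [ys], so once
   all quantifiers but the outermost one have been treated by induction, what
   remains has one free variable and is guarded by an equality. *)
Require Import Defs.
From mathcomp Require Import all_boot.
From Stdlib Require Import Classical.

Set Implicit Arguments.
Unset Strict Implicit.
Unset Printing Implicit Defensive.

(** * Semantics of formulas under renaming and replacement *)

Notation interpretation D := (forall R : rsym, (arity R).-tuple D -> Prop).

(** Keeping the domain fixed lets two interpretations be compared under the same assignment. *)
Notation satI I v phi := (@sat (Structure I) v phi).

Lemma satE (M : structure) (v : nat -> dom M) phi :
  sat v phi = satI (@interp M) v phi.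
Proof. by case: M v. Qed.

Lemma sat_agree D (I J : interpretation D) v w phi :
    (forall R t, R \in syms phi -> I R t <-> J R t) ->
    {in fv phi, v =1 w} ->
  satI I v phi <-> satI J w phi.
Proof.
elim: phi v w => [|R xs|x y|phi IH|phi IH psi IH'|phi IH psi IH'|x phi IH] v w /=.
- by [].
- move=> IJ vw; rewrite IJ ?inE //.
  suff -> : map_tuple v xs = map_tuple w xs by [].
  by apply/val_inj/eq_in_map.
- by move=> _ vw; rewrite !vw ?inE ?eqxx ?orbT.
- by move=> IJ vw; rewrite (IH v w).
- move=> IJ vw; rewrite (IH v w) ?(IH' v w) //.
  + by move=> R t Rs; apply: IJ; rewrite mem_cat Rs orbT.
  + by move=> z zs; apply: vw; rewrite mem_cat zs orbT.
  + by move=> R t Rs; apply: IJ; rewrite mem_cat Rs.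
  + by move=> z zs; apply: vw; rewrite mem_cat zs.
- move=> IJ vw; rewrite (IH v w) ?(IH' v w) //.
  + by move=> R t Rs; apply: IJ; rewrite mem_cat Rs orbT.
  + by move=> z zs; apply: vw; rewrite mem_cat zs orbT.
  + by move=> R t Rs; apply: IJ; rewrite mem_cat Rs.
  + by move=> z zs; apply: vw; rewrite mem_cat zs.
- move=> IJ vw; suff vwa a : satI I (update v x a) phi <-> satI J (update w x a) phi.
    by split=> -[a /vwa ?]; exists a.
  apply: IH => // z zs; rewrite /update; case: eqP => // /eqP zx.
  by apply: vw; rewrite mem_filter zx.
Qed.

Lemma eq_sat (M : structure) (v w : nat -> dom M) phi :
  {in fv phi, v =1 w} -> sat v phi <-> sat w phi.
Proof. by rewrite (satE v) (satE w) => vw; apply: sat_agree. Qed.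

Lemma ltn_fresh s x : x \in s -> x < fresh s.
Proof.
rewrite /fresh ltnS; elim: s => //= y s IH; rewrite inE leq_max.
by case/orP => [/eqP->|/IH->]; rewrite ?leqnn ?orbT.
Qed.

Lemma fresh_notin s : fresh s \notin s.
Proof. by apply/negP => /ltn_fresh; rewrite ltnn. Qed.

(** Freshness of [z] for the images of the other free variables makes the update at [z] visible only
    through [x]. *)
Lemma sat_update_rename (M : structure) (v : nat -> dom M) f x z a phi :
    z \notin [seq f y | y <- fv (Ex x phi)] ->
  sat (fun y => update v z a (update f x z y)) phi <->
  sat (update (fun y => v (f y)) x a) phi.
Proof.
move=> zs; apply: eq_sat => y yphi; rewrite /update.
have [_|yx] := eqVneq y x; first by rewrite eqxx.
case: eqP => // fy; case/negP: zs; rewrite -fy; apply: map_f.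
by rewrite mem_filter yx.
Qed.

Lemma sat_rename (M : structure) (v : nat -> dom M) f phi :
  sat v (rename f phi) <-> sat (fun x => v (f x)) phi.
Proof.
elim: phi v f => [|R xs|x y|phi IH|phi IH psi IH'|phi IH psi IH'|x phi IH] v f //=.
- suff -> : map_tuple v (map_tuple f xs) = map_tuple (fun x => v (f x)) xs by [].
  by apply: val_inj; rewrite /= -map_comp.
- by rewrite IH.
- by rewrite IH IH'.
- by rewrite IH IH'.
- have ext a := sat_update_rename v a (fresh_notin [seq f y | y <- fv (Ex x phi)]).
  by split=> -[a sata]; exists a; move: sata; rewrite IH => /ext.
Qed.

Lemma syms_rename f phi : syms (rename f phi) = syms phi.
Proof. by elim: phi f => //= [phi IH psi IH'|phi IH psi IH'] f; rewrite IH IH'. Qed.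

Lemma fv_rename f phi : fv (rename f phi) =i [seq f x | x <- fv phi].
Proof.
elim: phi f => [|R xs|x y|phi IH|phi IH psi IH'|phi IH psi IH'|x phi IH] f z //=.
- by rewrite IH.
- by rewrite map_cat !mem_cat IH IH'.
- by rewrite map_cat !mem_cat IH IH'.
set s := map f _; have /negP zs := fresh_notin s.
rewrite mem_filter IH; apply/andP/mapP => [[zf /mapP[y yphi zE]]|[y yphi ->]].
  move: zf; rewrite zE /update; case: (eqVneq y x) => [_|yx _]; first by rewrite eqxx.
  by exists y => //; rewrite mem_filter yx.
split; first by apply: contra_notN zs => /eqP <-; apply: map_f.
move: yphi; rewrite mem_filter => /andP[/negPf yx yphi].
by apply/mapP; exists y; rewrite // /update yx.
Qed.

Lemma atomic_rename f phi : atomic (rename f phi) = atomic phi.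
Proof. by case: phi. Qed.

(** A quantifier block amounts to one change of assignment on [xs], whatever the order and
    repetitions there. *)
Lemma sat_exs (M : structure) (v : nat -> dom M) xs phi :
  sat v (exs xs phi) <->
  exists2 w : nat -> dom M, (forall z, z \notin xs -> w z = v z) & sat w phi.
Proof.
elim: xs v => [|x xs IH] v /=.
  by split=> [?|[w wv]]; [exists v | rewrite (@eq_sat _ w v) // => z _; apply: wv].
split=> [[a /IH[w wv wphi]]|[w wv wphi]].
  exists w => // z; rewrite inE negb_or => /andP[zx /wv->].
  by rewrite /update (negPf zx).
exists (w x); apply/IH; exists w => // z zxs; rewrite /update.
by case: eqVneq => [->|zx] //; apply: wv; rewrite inE negb_or zx.
Qed.

Lemma fv_exs xs phi z : (z \in fv (exs xs phi)) = (z \in fv phi) && (z \notin xs).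
Proof.
elim: xs => [|x xs IH] /=; first by rewrite andbT.
by rewrite mem_filter IH inE negb_or andbA [_ && (z \in _)]andbC -andbA.
Qed.

Lemma syms_exs xs phi : syms (exs xs phi) = syms phi.
Proof. by elim: xs. Qed.

Lemma replace_exs R xs psi ys phi :
  replace R xs psi (exs ys phi) = exs ys (replace R xs psi phi).
Proof. by elim: ys => //= y ys ->. Qed.

Lemma replace_notin R xs psi phi : R \notin syms phi -> replace R xs psi phi = phi.
Proof.
elim: phi => //= [Q ys|phi IH /IH-> //|phi IH psi' IH'|phi IH psi' IH'|x phi IH /IH->//].
- by rewrite inE eq_sym; case: eqP.
- by rewrite mem_cat negb_or => /andP[/IH-> /IH'->].
- by rewrite mem_cat negb_or => /andP[/IH-> /IH'->].
Qed.

Lemma mem_syms_replace R xs psi phi Q :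
  (Q \in syms (replace R xs psi phi)) =
  ((Q \in syms phi) && (Q != R)) || ((R \in syms phi) && (Q \in syms psi)).
Proof.
elim: phi => //= [P ys|phi IH psi' IH'|phi IH psi' IH'].
- have [PR|PR] := boolP (P == R).
    by rewrite /inst syms_rename !inE (eqP PR) eqxx; case: eqP.
  rewrite /= !inE (eq_sym R) (negPf PR) orbF.
  by case: eqP => // ->; rewrite PR.
- by rewrite !mem_cat IH IH' !andb_orl orbACA.
- by rewrite !mem_cat IH IH' !andb_orl orbACA.
Qed.

(** The relation defined by [psi] becomes the meaning of [R]. The assignment [w] is existentially
    quantified because [D] provides no default value for variables outside [xs]. *)
Definition reinterp D (I : interpretation D) (R : rsym) (xs : seq nat)
    (psi : formula) : interpretation D :=
  fun Q t => if Q == R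
    then exists2 w : nat -> D, map w xs = t & satI I w psi
    else I Q t.

Lemma sat_replace D (I : interpretation D) R (xs : (arity R).-tuple nat) psi phi
    (v : nat -> D) :
    uniq xs -> {subset fv psi <= xs} ->
  satI I v (replace R xs psi phi) <-> satI (reinterp I R xs psi) v phi.
Proof.
move=> Uxs sub.
elim: phi v => [|Q ys|x y|phi IH|phi IH psi' IH'|phi IH psi' IH'|x phi IH] v //=.
- rewrite /reinterp; case: eqP => // QR; subst Q; rewrite /inst.
  rewrite sat_rename; set f := fun x => v _.
  have fxs : map f xs = map v ys.
    rewrite [map f xs](map_comp v); congr map.
    apply: (@eq_from_nth _ 0) => [|i]; rewrite size_map !size_tuple // => ltiR.
    rewrite (nth_map 0) ?size_tuple // index_uniq ?size_tuple //.
    by apply: set_nth_default; rewrite size_tuple.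
  split=> [?|[w wxs]]; first by exists f.
  (* Two assignments that send [xs] to the same tuple agree on the free variables of [psi]. *)
  have /eq_in_map wf : map w xs = map f xs by rewrite fxs wxs.
  by rewrite (@eq_sat (Structure I) w f) // => x /sub /wf.
- by rewrite IH.
- by rewrite IH IH'.
- by rewrite IH IH'.
- by split=> -[a /IH ?]; exists a.
Qed.

Lemma inst_id (M : structure) (v : nat -> dom M) xs psi :
  sat v (inst xs xs psi) <-> sat v psi.
Proof.
rewrite /inst sat_rename; apply: eq_sat => x _; congr v.
have [xxs|xxs] := boolP (x \in xs); first by rewrite nth_index.
(* Outside [xs] the default of [nth] in [inst] is the variable itself. *)
by rewrite nth_default // leqNgt index_mem.
Qed.

(** * Fresh symbols and marking predicates *)

(** Names from [n] on are reserved for fresh symbols, so [J] can be chosen freely without affecting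
    formulas that use smaller names. *)
Definition override D n (J I : interpretation D) : interpretation D :=
  fun R t => if n <= R.1 then J R t else I R t.

Lemma sat_override D n (J I : interpretation D) v phi :
  {in syms phi, forall R, R.1 < n} ->
  satI (override n J I) v phi <-> satI I v phi.
Proof.
by move=> lt_n; apply: sat_agree => // R t /lt_n; rewrite /override ltnNge => /negPf->.
Qed.

Lemma fresh_name phi : exists n, {in syms phi, forall R, R.1 < n}.
Proof. by exists (fresh [seq R.1 | R <- syms phi]) => R Rphi; apply/ltn_fresh/map_f. Qed.

Lemma equivalent_exs ys phi psi :
  equivalent phi psi -> equivalent (exs ys phi) (exs ys psi).
Proof. by move=> eqv M v; rewrite !sat_exs; split=> -[w wv /eqv]; exists w. Qed.

Definition named n (xs : seq nat) : formula := @Atom (n, size xs) (in_tuple xs).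

(** Each variable [u] gets its own unary predicate, which can later be interpreted as a singleton to
    pin the value of [u]. *)
Definition marked n us : formula :=
  foldr (fun u => And (named (n + u) [:: u])) Top us.

Lemma fv_marked n us : fv (marked n us) = us.
Proof. by elim: us => //= u us ->. Qed.

Lemma mem_syms_marked n us R :
  R \in syms (marked n us) -> exists u, R = (n + u, 1).
Proof.
by elim: us => //= u us IH; rewrite inE => /orP[/eqP->|/IH//]; exists u.
Qed.

Lemma GFO_marked n us : GFO (marked n us).
Proof. by elim: us => /= *; [apply: GFO_top | apply: GFO_and => //; apply: GFO_atom]. Qed.

Lemma sat_marked (M : structure) (v : nat -> dom M) n us :
  sat v (marked n us) <-> {in us, forall u, sat v (named (n + u) [:: u])}.
Proof.
elim: us => [|u us IH] //; split=> [[satu /IH satus] x|satus].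
  by rewrite inE => /orP[/eqP->|/satus].
split; first by apply: satus; rewrite inE eqxx.
by apply/IH => x xus; apply: satus; rewrite inE xus orbT.
Qed.

(** * Closure properties of the fragment *)

Section Closure.

Context (L : formula -> Prop)
  (hGFO : forall phi : formula, GFO phi -> self_guarded phi -> expressible L phi)
  (hsubst : closed_under_sg_substitution L)
  (handor : closed_under_and_or L)
  (hcraig : craig_interpolation L).

Local Notation E := (expressible L).

Lemma expressible_equivalent phi psi :
  E phi -> equivalent phi psi -> {subset syms phi <= syms psi} -> E psi.
Proof.
move=> [chi [Lchi eqv sub]] eqv' sub'; exists chi; split=> //.
  by move=> M v; rewrite -eqv' eqv.
by move=> R /sub /sub'.
Qed.

Lemma expressible_and phi psi : E phi -> E psi -> E (And phi psi).
Proof.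
move=> [phi' [Lphi eqv sub]] [psi' [Lpsi eqv' sub']].
have [Eand _] := handor Lphi Lpsi; apply: expressible_equivalent Eand _ _.
  by move=> M v /=; rewrite eqv eqv'.
by move=> R; rewrite /= !mem_cat => /orP[/sub->|/sub'->]; rewrite ?orbT.
Qed.

Lemma expressible_or phi psi : E phi -> E psi -> E (Or phi psi).
Proof.
move=> [phi' [Lphi eqv sub]] [psi' [Lpsi eqv' sub']].
have [_ Eor] := handor Lphi Lpsi; apply: expressible_equivalent Eor _ _.
  by move=> M v /=; rewrite eqv eqv'.
by move=> R; rewrite /= !mem_cat => /orP[/sub->|/sub'->]; rewrite ?orbT.
Qed.

Lemma expressible_sentence phi : GFO phi -> fv phi =i [::] -> E phi.
Proof.
move=> GFOphi fv0; apply: hGFO => //; left.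
by case: (fv phi) fv0 => // x s /(_ x); rewrite inE eqxx.
Qed.

Lemma self_guarded_and alpha phi :
  atomic alpha -> {subset fv phi <= fv alpha} -> self_guarded (And alpha phi).
Proof. by move=> ? ?; right; exists alpha, phi; split=> //; exists [::], alpha. Qed.

Lemma GFO_atomic alpha : atomic alpha -> GFO alpha.
Proof. by case: alpha => // *; [apply: GFO_atom | apply: GFO_eq]. Qed.

Lemma expressible_guarded alpha phi :
  atomic alpha -> GFO phi -> {subset fv phi <= fv alpha} -> E (And alpha phi).
Proof.
move=> at_a GFOphi sub; apply: hGFO; last exact: self_guarded_and.
by apply: GFO_and => //; apply: GFO_atomic.
Qed.

Lemma expressible_top : E Top.
Proof. by apply: expressible_sentence => //; apply: GFO_top. Qed.

Lemma expressible_atomic alpha : atomic alpha -> E alpha.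
Proof.
move=> at_a; have Ea : E (And alpha Top) by apply: expressible_guarded => //; apply: GFO_top.
apply: expressible_equivalent Ea _ _ => [M v /=|R]; first by split=> [[]|].
by rewrite /= cats0.
Qed.

Lemma expressible_marked n us : E (marked n us).
Proof.
elim: us => [|u us IH]; first exact: expressible_top.
by apply: expressible_and => //; apply: expressible_atomic.
Qed.

(** Transfers closure under substitution from members of [L] to formulas expressible in [L]; the
    guard [alpha] supplies exactly the free variables [xs]. *)
Lemma expressible_replace phi n xs alpha psi :
    E phi -> atomic alpha -> E (And alpha psi) -> {subset fv psi <= fv alpha} ->
    uniq xs -> fv alpha =i xs ->
  E (replace (n, size xs) xs (And alpha psi) phi).
Proof.
move=> [phi' [Lphi eqv sub]] at_a Epsi sub_psi Uxs fva.
set R := (n, size xs); set chi := And alpha psi.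
have fvchi : fv chi =i xs.
  move=> x; rewrite /= mem_cat -fva; case: (boolP (x \in fv psi)) => [/sub_psi->|] //.
  by rewrite orbF.
have Echi : E (replace R xs chi phi').
  (* The witness in [L] may have dropped [R], and then the replacement leaves it unchanged. *)
  have [Rphi|Rphi] := boolP (R \in syms phi'); last first.
    by rewrite replace_notin //; exists phi'; split.
  by apply: (@hsubst _ R (in_tuple xs)) => //; apply: self_guarded_and.
apply: expressible_equivalent Echi _ _ => [M v|Q].
  have sub_chi : {subset fv chi <= xs} by move=> x; rewrite fvchi.
  rewrite !(satE v) !(@sat_replace _ _ R (in_tuple xs)) //.
  by have := eqv (Structure (reinterp (@interp M) R xs chi)) v => ->.
rewrite !mem_syms_replace => /orP[/andP[/sub-> ->] //|/andP[/sub-> ->]].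
by rewrite orbT.
Qed.

(** Start from [alpha /\ ~ G(ws)] with [G] fresh for [alpha] and substitute [alpha /\ phi] for [G];
    the result [alpha /\ ~ (alpha /\ phi)] is equivalent to the goal. *)
Lemma expressible_not alpha phi :
  atomic alpha -> E phi -> {subset fv phi <= fv alpha} -> E (And alpha (Not phi)).
Proof.
move=> at_a Ephi sub; set ws := undup (fv alpha).
have [n lt_n] := fresh_name alpha.
have Eneg : E (And alpha (Not (named n ws))).
  apply: expressible_guarded => // [|x]; last by rewrite mem_undup.
  by apply: GFO_not; apply: GFO_atom.
have Ephi' : E (And alpha phi) by apply: expressible_and => //; apply: expressible_atomic.
have := @expressible_replace _ n ws _ _ Eneg at_a Ephi' sub (undup_uniq _).
move/(_ (fun x => esym (mem_undup _ x))).
have notin : (n, size ws) \notin syms alpha by apply/negP => /lt_n; rewrite ltnn.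
rewrite [replace _ _ _ _]/= eqxx (replace_notin _ _ notin) => Eneg'.
apply: expressible_equivalent Eneg' _ _ => [M v|R].
  by cbn -[inst]; rewrite inst_id /=; tauto.
by rewrite /inst /= !syms_rename !mem_cat orbA orbb.
Qed.

(** * Existential quantification by interpolation *)

(* The interpolation step; [P_u] is the symbol [(n.+2 + u, 1)], and [sigma] may
   be weaker than [exists ys, phi] except when each [P_u] is a singleton. *)
Lemma expressible_exs n ys phi sigma :
    {in syms phi, forall R, R.1 < n} -> E phi -> E sigma ->
    {in syms sigma, forall R, R \in syms phi \/ exists u, R = (n.+2 + u, 1)} ->
    (forall (M : structure) (v : nat -> dom M),
      sat v (marked n.+2 (fv (exs ys phi))) ->
      sat v (exs ys phi) -> sat v sigma) ->
    (forall (M : structure) (v : nat -> dom M),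
      (forall u (w : nat -> dom M), u \in fv (exs ys phi) ->
        sat w (named (n.+2 + u) [:: u]) -> w u = v u) ->
      sat v sigma -> sat v (exs ys phi)) ->
  E (exs ys phi).
Proof.
move=> lt_n Ephi Esigma syms_sigma fwd bwd.
set us := fv (exs ys phi) in fwd bwd *.
set ws := undup (fv phi).
(* [G] and [G'] are named [n] and [n.+1]. The final [Top] is the body of the guarded quantifier in
   the base formula below. *)
pose psi1 := And (named n.+1 us) (exs ys (And (And (named n ws) phi) Top)).
have Epsi1 : E psi1.
  have fv_ws : fv (named n ws) =i ws by [].
  (* [phi] enters by substituting [G /\ phi] for [G] in a base formula, so that [G] remains as its
     guard. *)
  have Ebase : E (And (named n.+1 us) (exs ys (And (named n ws) Top))).
    apply: expressible_guarded => // [|x].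
      by apply: GFO_ex; [split | apply: GFO_top].
    by rewrite /us !fv_exs /= cats0 mem_undup.
  have Egphi : E (And (named n ws) phi).
    by apply: expressible_and => //; apply: expressible_atomic.
  have sub : {subset fv phi <= fv (named n ws)} by move=> x; rewrite /= mem_undup.
  have := @expressible_replace _ n ws (named n ws) _ Ebase isT Egphi sub (undup_uniq _) fv_ws.
  rewrite /= replace_exs /= eqxx.
  rewrite xpair_eqE /= eqn_leq ltnn /= => Epsi.
  apply: expressible_equivalent Epsi _ _ => [M v|R].
    have eqv : equivalent
        (exs ys (And (inst ws ws (And (named n ws) phi)) Top))
        (exs ys (And (And (named n ws) phi) Top)).
      by apply: equivalent_exs => M' v'; cbn -[inst]; rewrite inst_id.
    by have := eqv M v; rewrite /psi1 /=; tauto.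
  by rewrite /= !syms_exs /= /inst syms_rename.
(* The trivial equality guards each negated atom, which makes every added disjunct self-guarded. *)
pose psi2 := foldr (fun u => Or (And (Eq u u) (Not (named (n.+2 + u) [:: u])))) sigma us.
have Epsi2 : E psi2.
  rewrite /psi2; elim: (us) => //= u us' IH; apply: expressible_or => //.
  apply: expressible_guarded => // [|x]; last by rewrite /= !inE => ->.
  by apply: GFO_not; apply: GFO_atom.
have sat_psi2 (M : structure) (v : nat -> dom M) :
    sat v psi2 <-> (sat v (marked n.+2 us) -> sat v sigma).
  rewrite /psi2; elim: (us) => [|u us' IH] /=; first by tauto.
  by rewrite IH; have := classic (sat v (named (n.+2 + u) [:: u])) => /=; tauto.
have syms_psi2 : {in syms psi2, forall R, R \in syms phi \/ exists u, R = (n.+2 + u, 1)}.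
  rewrite /psi2; elim: (us) => //= u us' IH R; rewrite inE => /orP[/eqP->|/IH//].
  by right; exists u.
have [phi1 [Lphi1 eqv1 sub1]] := Epsi1; have [phi2 [Lphi2 eqv2 sub2]] := Epsi2.
have [|theta [Ltheta ent1 ent2 subt1 subt2]] := hcraig Lphi1 Lphi2.
  move=> M v /eqv1 [_ satphi]; apply/eqv2/sat_psi2 => /fwd; apply.
  by apply/sat_exs; case/sat_exs: satphi => w wv [[]]; exists w.
have sub_theta : {subset syms theta <= syms phi}.
  (* The guards occur only in [psi1] and the [P_u] only in [psi2], so the shared symbols come from
     [phi]. *)
  move=> R Rt; have /sub1 := subt1 _ Rt; have /sub2 := subt2 _ Rt.
  case/syms_psi2 => // -[u ->]; rewrite /= syms_exs /= cats0 !inE.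
  have lt2 : n.+1 < n.+2 + u by rewrite !addSn !ltnS leq_addr.
  by rewrite !xpair_eqE (gtn_eqF lt2) (gtn_eqF (ltnW lt2)).
exists theta; split=> // [M v|R Rt]; last by rewrite syms_exs sub_theta.
have lt_theta : {in syms theta, forall R, R.1 < n} by move=> R /sub_theta /lt_n.
split=> [/sat_exs [w wv satphi]|satt].
  (* With all names from [n] on interpreted as full relations, both guards hold everywhere. *)
  rewrite (satE v) -(@sat_override _ n (fun _ _ => True)) //.
  apply/ent1/eqv1; split; first by rewrite /= /override leqW.
  apply/sat_exs; exists w => //; split=> //; split; first by rewrite /= /override leqnn.
  by rewrite -[sat _ _]/(satI _ w phi) sat_override // -satE.
have lt_exs : {in syms (exs ys phi), forall R, R.1 < n} by rewrite syms_exs.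
(* Subtracting [n.+2] from the name of [P_u] recovers [u], so [P_u] holds of [v u] alone. *)
pose J R (t : (arity R).-tuple (dom M)) :=
  tval t = nseq (arity R) (v (R.1 - n.+2)).
have satP u (w : nat -> dom M) :
    satI (override n J (@interp M)) w (named (n.+2 + u) [:: u]) <-> w u = v u.
  have le_nu : n <= n.+2 + u by rewrite !addSn 2?leqW ?leq_addr.
  by rewrite /= /override /= le_nu /J [_.1 - _]addKn; split=> [[]|/= ->].
rewrite (satE v) -(@sat_override _ n J) //.
apply: (bwd (Structure (override n J (@interp M)))) => [u w _ /satP //|].
have /sat_psi2 : satI (override n J (@interp M)) v psi2.
  apply/eqv2/ent2; rewrite -[sat _ _]/(satI _ v theta) sat_override //.
  by rewrite -satE.
by apply; apply/sat_marked => u _; apply/satP.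
Qed.

(** The interpolation step applies with [sigma] the sentence that also quantifies the remaining
    variables of [beta] and marks them; singleton marks restore their values. *)
Lemma expressible_guarded_exs xs beta phi :
    atomic beta -> E (And beta phi) -> {subset fv phi <= fv beta} ->
  E (exs xs (And beta phi)).
Proof.
move=> at_b Ephi sub; have [n lt_n] := fresh_name (And beta phi).
set chi := And beta phi in lt_n Ephi *.
have fv_chi : fv chi =i fv beta.
  by move=> z; rewrite mem_cat; case: (boolP (z \in fv phi)) => [/sub->|]; rewrite ?orbF.
set us := fv (exs xs chi); set zs := fv beta ++ xs; set ws := undup (fv beta).
have Esigma : E (exs zs (And chi (marked n.+2 us))).
  have Ebase : E (exs zs (And (named n ws) (marked n.+2 us))).
    have sub_us : {subset us <= ws}.
      by move=> z; rewrite fv_exs fv_chi mem_undup => /andP[].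
    apply: expressible_sentence => [|z].
      apply: GFO_ex; last exact: GFO_marked.
      by split=> // z; rewrite fv_marked; apply: sub_us.
    rewrite fv_exs /= fv_marked !mem_cat mem_undup negb_or.
    have [zus|_] /= := boolP (z \in us); last by rewrite orbF andbA andbN.
    by move/sub_us: zus; rewrite mem_undup => ->.
  have := @expressible_replace _ n ws _ _ Ebase at_b Ephi sub (undup_uniq _).
  move/(_ (fun x => esym (mem_undup _ x))); rewrite replace_exs /=.
  rewrite eqxx.
  have notin : (n, size ws) \notin syms (marked n.+2 us).
    apply/negP => /mem_syms_marked [u] [/eqP].
    by rewrite ltn_eqF // !addSn ltnS leqW ?leq_addr.
  rewrite replace_notin // => Esigma; apply: expressible_equivalent Esigma _ _.
    by apply: equivalent_exs => M v; cbn -[inst]; rewrite inst_id.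
  by move=> R; rewrite !syms_exs /= !syms_rename.
apply: (expressible_exs lt_n Ephi Esigma) => [R|M v sat_us|M v P_us].
- rewrite syms_exs mem_cat => /orP[->|/mem_syms_marked]; first by left.
  by right.
- move/sat_exs => [w wv satw]; apply/sat_exs; exists w => [z|].
    by rewrite mem_cat negb_or => /andP[_ /wv].
  split=> //; apply/sat_marked => u uus; move/sat_marked/(_ u uus): sat_us.
  rewrite (@eq_sat _ v w) // => z; rewrite inE => /eqP->; apply/esym/wv.
  by move: uus; rewrite fv_exs => /andP[].
- move/sat_exs => [w wv [satw /sat_marked sat_us]]; apply/sat_exs.
  (* Outside [xs] the values of [v] are put back; the marks make [w] agree with them on the free
     variables. *)
  exists (fun z => if z \in xs then w z else v z) => [z /negPf-> //|].
  rewrite (@eq_sat _ _ w) // => z zchi; case: ifPn => // zxs.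
  have zus : z \in us by rewrite fv_exs zchi.
  by rewrite (P_us z w) //; apply: sat_us.
Qed.

(** * Conjunctions of guarded formulas *)

(** The block [zs] keeps the class stable when more variables are quantified inside a conjunct.
    Bodies are constrained only through expressibility, so guarded negations already treated may
    occur in them. *)
Inductive guarded_conj : formula -> Prop :=
  | guarded_conj_top : guarded_conj Top
  | guarded_conj_and zs beta phi psi :
      atomic beta -> E (And beta phi) -> {subset fv phi <= fv beta} ->
      guarded_conj psi -> guarded_conj (And (exs zs (And beta phi)) psi).

Lemma expressible_guarded_conj chi : guarded_conj chi -> E chi.
Proof.
elim=> [|zs beta phi psi at_b Ephi sub _ IH]; first exact: expressible_top.
by apply: expressible_and => //; apply: expressible_guarded_exs.
Qed.

(* The free variables of each conjunct outside [ys] are quantified away locally,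
   constrained only by the predicates naming them. *)
Lemma guarded_conj_relativize (ys : seq nat) n chi :
  guarded_conj chi ->
  exists chi',
    [/\ guarded_conj chi', {subset fv chi' <= ys},
        {in syms chi', forall R, R \in syms chi \/ exists u, R = (n + u, 1)},
        forall (M : structure) (w : nat -> dom M),
          (forall u, u \in fv chi -> u \notin ys -> sat w (named (n + u) [:: u])) ->
          sat w chi -> sat w chi'
      & forall (M : structure) (w : nat -> dom M),
          (forall u (w' : nat -> dom M), u \in fv chi -> u \notin ys ->
            sat w' (named (n + u) [:: u]) -> w' u = w u) ->
          sat w chi' -> sat w chi].
Proof.
elim=> {chi} [|zs beta phi psi at_b Ephi sub _ [psi' [gc_psi' fv_psi' syms_psi' fwd bwd]]].
  by exists Top; split=> //; apply: guarded_conj_top.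
set chi := exs zs (And beta phi).
set us := [seq u <- fv chi | u \notin ys].
have us_chi u : u \in us -> u \in fv chi /\ u \notin ys.
  by rewrite mem_filter => /andP[].
have fv_chi z : (z \in fv chi) = (z \in fv beta) && (z \notin zs).
  rewrite fv_exs mem_cat; congr (_ && _).
  by case: (boolP (z \in fv phi)) => [/sub->|]; rewrite ?orbF.
(* All of [us] occurs in [beta], so adding the marks keeps the body guarded by [beta]. *)
exists (And (exs (us ++ zs) (And beta (And phi (marked n us)))) psi'); split.
- apply: guarded_conj_and => //.
    have Emarked : E (And (And beta phi) (marked n us)).
      by apply: expressible_and => //; apply: expressible_marked.
    apply: expressible_equivalent Emarked _ _ => [M v /=|R]; first by tauto.
    by rewrite /= catA.
  move=> z; rewrite /= fv_marked mem_cat => /orP[/sub //|/us_chi [+ _]].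
  by rewrite fv_chi => /andP[].
- move=> z; rewrite /= mem_cat => /orP[|/fv_psi' //].
  rewrite fv_exs /= fv_marked !mem_cat negb_or => /andP[zbp /andP[zus zzs]].
  apply: contraNT zus => zys; rewrite mem_filter zys fv_chi zzs andbT /=.
  move: zbp; case/or3P => // [/sub //|]; rewrite mem_filter fv_chi.
  by case/and3P.
- move=> R; rewrite /= !mem_cat !syms_exs /= !mem_cat -!orbA.
  case/or4P => [->|->|/mem_syms_marked|/syms_psi' [->|]]; rewrite ?orbT; auto.
- move=> M w P_us [/sat_exs [w' w'w [satb satp]] satpsi]; split; last first.
    by apply: fwd => // u upsi; apply: P_us; rewrite mem_cat upsi orbT.
  apply/sat_exs; exists w' => [z|].
    by rewrite mem_cat negb_or => /andP[_ /w'w].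
  split=> //; split=> //; apply/sat_marked => u /us_chi [uchi uys].
  have := P_us u; rewrite mem_cat uchi => /(_ isT uys).
  rewrite (@eq_sat _ w w') // => z; rewrite inE => /eqP->; apply/esym/w'w.
  by move: uchi; rewrite fv_chi => /andP[].
- move=> M w P_us [/sat_exs [w' w'w [satb [satp /sat_marked sat_us]]] satpsi].
  split; last first.
    by apply: bwd => // u v upsi; apply: P_us; rewrite mem_cat upsi orbT.
  apply/sat_exs; exists w' => // z zzs.
  (* [w'] may move the variables of [us], but the singleton marks force them back to their values in
     [w]. *)
  have [zus|zus] := boolP (z \in us); last by rewrite w'w // mem_cat negb_or zus.
  have [zchi zys] := us_chi z zus.
  by apply: P_us => //; [rewrite mem_cat zchi | apply: sat_us].
Qed.

(** Induction on [ys] for all [chi], since the induction hypothesis is applied to the relativized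
    conjunction [chi']. *)
Lemma expressible_exs_guarded_conj ys chi : guarded_conj chi -> E (exs ys chi).
Proof.
elim: ys chi => [|y ys IH] chi gc_chi; first exact: expressible_guarded_conj.
have [n lt_n] := fresh_name chi.
have [chi' [gc_chi' fv_chi' syms_chi' fwd bwd]] :=
  guarded_conj_relativize (y :: ys) n.+2 gc_chi.
(* Only [y] can be free in [exs ys chi'], so [y = y] is a guard. *)
have Esigma : E (Ex y (And (Eq y y) (exs ys chi'))).
  apply: (@expressible_guarded_exs [:: y]) => // [|z].
    by apply: expressible_and; [apply: expressible_atomic | apply: IH].
  rewrite fv_exs !inE => /andP[/fv_chi']; rewrite inE orbb.
  by case/orP => // ->.
have Echi := expressible_guarded_conj gc_chi.
have sigmaE : equivalent (Ex y (And (Eq y y) (exs ys chi'))) (exs (y :: ys) chi').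
  by move=> M v; split=> -[a]; [case | ]; exists a.
apply: (expressible_exs (ys := y :: ys) lt_n Echi Esigma)
  => [R|M v /sat_marked sat_us|M v P_us].
- by rewrite /= syms_exs; apply: syms_chi'.
- move/sat_exs => [w wv satw]; apply/sigmaE/sat_exs; exists w => //.
  apply: fwd => // u uchi uys; have := sat_us u; rewrite fv_exs uchi => /(_ uys).
  by rewrite (@eq_sat _ v w) // => z; rewrite inE => /eqP->; apply/esym/wv.
- move/sigmaE/sat_exs => [w wv satw]; apply/sat_exs; exists w => //.
  apply: bwd satw => u w' uchi uys /P_us ->; first by rewrite wv.
  by rewrite fv_exs uchi.
Qed.

(** * Reduction of guarded-negation formulas to guarded conjunctions *)

(* [rho] stands for the part of a conjunction still to be processed; the
   renamings keep the bound variables pulled out of it apart. *)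
Definition absorbable rho :=
  forall ys chi, guarded_conj chi -> E (exs ys (And rho chi)).

Lemma absorbable_top : absorbable Top.
Proof.
move=> ys chi /(expressible_exs_guarded_conj ys) Echi.
apply: expressible_equivalent Echi _ _ => [|R]; last by rewrite !syms_exs.
by apply: equivalent_exs => M v /=; tauto.
Qed.

Lemma absorbable_guarded alpha phi rho :
    atomic alpha -> E (And alpha phi) -> {subset fv phi <= fv alpha} ->
  absorbable rho -> absorbable (And (And alpha phi) rho).
Proof.
move=> at_a Ephi sub Krho ys chi gc_chi.
(* The guarded conjunct moves into [chi] with an empty quantifier block. *)
have Erho := Krho ys _ (@guarded_conj_and [::] _ _ _ at_a Ephi sub gc_chi).
apply: expressible_equivalent Erho _ _ => [|R].
  by apply: equivalent_exs => M v /=; tauto.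
rewrite !syms_exs /= !mem_cat -!orbA.
by case/or4P => ->; rewrite ?orbT.
Qed.

Lemma absorbable_equivalent rho rho' :
    absorbable rho -> equivalent rho rho' -> {subset syms rho <= syms rho'} ->
  absorbable rho'.
Proof.
move=> Krho eqv sub ys chi /(Krho ys) Erho.
apply: expressible_equivalent Erho _ _ => [|R].
  by apply: equivalent_exs => M v /=; rewrite eqv.
by rewrite !syms_exs !mem_cat => /orP[/sub->|->]; rewrite ?orbT.
Qed.

Lemma absorbable_atomic alpha rho :
  atomic alpha -> absorbable rho -> absorbable (And alpha rho).
Proof.
move=> at_a Krho; have Ea : E (And alpha Top).
  by apply: expressible_and; [apply: expressible_atomic | apply: expressible_top].
have sub : {subset fv Top <= fv alpha} by [].
apply: absorbable_equivalent (absorbable_guarded at_a Ea sub Krho) _ _ => [M v /=|R].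
  by tauto.
by rewrite /= cats0.
Qed.

(** Induction on [phi] for all [f] and [rho]: the block distributes over disjunctions, conjuncts are
    absorbed one after the other, bound variables join the block under fresh names, and guarded
    negations become guarded conjuncts. *)
Lemma GNFO_absorbable phi : GNFO phi ->
  forall f rho, absorbable rho -> absorbable (And (rename f phi) rho).
Proof.
elim=> {phi} [|R xs|x y|phi psi _ IH _ IH'|phi psi _ IH _ IH'|x phi _ IH
             |alpha phi [at_a sub] _ IH] f rho Krho.
- by apply: absorbable_equivalent Krho _ _ => // M v /=; tauto.
- exact: absorbable_atomic.
- exact: absorbable_atomic.
- move=> ys chi gc_chi.
  have Eor := expressible_or (IH f rho Krho ys chi gc_chi) (IH' f rho Krho ys chi gc_chi).
  apply: expressible_equivalent Eor _ _ => [M v|R].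
    split=> [[/sat_exs|/sat_exs]|/sat_exs] [w wv /= satw].
    + by apply/sat_exs; exists w => //=; tauto.
    + by apply/sat_exs; exists w => //=; tauto.
    + by case: satw => -[[satw|satw] satr satc]; [left | right]; apply/sat_exs; exists w.
  rewrite /= !mem_cat !syms_exs /= !mem_cat.
  by case/orP => /orP[/orP[]|] ->; rewrite ?orbT.
- apply: absorbable_equivalent (IH f _ (IH' f rho Krho)) _ _ => [M v /=|R].
    by tauto.
  by rewrite /= catA.
- move=> ys chi gc_chi.
  set s := [seq f y | y <- fv (Ex x phi)].
  (* Freshness for [rho] and [chi] lets the scope of the quantifier extend over them. *)
  set z := fresh (s ++ fv rho ++ fv chi).
  have := fresh_notin (s ++ fv rho ++ fv chi).
  rewrite -/z !mem_cat !negb_or => /and3P[zs zrho zchi].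
  have Ephi := IH (update f x z) rho Krho (rcons ys z) chi gc_chi.
  apply: expressible_equivalent Ephi _ _ => [|R]; last first.
    by rewrite !syms_exs /= !syms_rename.
  rewrite /exs foldr_rcons; apply: equivalent_exs => M v.
  have off psi a : z \notin fv psi -> sat (update v z a) psi <-> sat v psi.
    move=> zpsi; apply: eq_sat => y ypsi; rewrite /update.
    by case: eqP => // yz; rewrite -yz ypsi in zpsi.
  have updE a : sat (update v z a) (rename (update f x z) phi)
      <-> sat (update (fun y => v (f y)) x a) phi.
    by rewrite sat_rename sat_update_rename.
  have renE := sat_rename v f (Ex x phi).
  split=> [[a [[/updE sata /(off _ _ zrho) satr] /(off _ _ zchi) satc]]|].
    by split=> //; split=> //; apply/renE; exists a.
  move=> [[/renE [a sata] satr] satc].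
  by exists a; split; [split; [apply/updE | apply/off] | apply/off].
- have at_fa : atomic (rename f alpha) by rewrite atomic_rename.
  have sub_f : {subset fv (rename f phi) <= fv (rename f alpha)}.
    move=> z; rewrite !fv_rename => /mapP[y /sub ya ->]; exact: map_f.
  apply: absorbable_guarded => //; apply: expressible_not => //.
  (* With an empty block and trivial [rho] and [chi], the induction hypothesis makes the renamed
     [phi] itself expressible. *)
  have Ephi := IH f _ absorbable_top [::] _ guarded_conj_top.
  apply: expressible_equivalent Ephi _ _ => [M v /=|R]; first by tauto.
  by rewrite /= !cats0.
Qed.

End Closure.

Theorem theorem2 (L : formula -> Prop)
    (hGFO : forall phi : formula, GFO phi -> self_guarded phi -> expressible L phi)
    (hsubst : closed_under_sg_substitution L)
    (handor : closed_under_and_or L)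
    (hcraig : craig_interpolation L) :
  forall phi : formula, GNFO phi -> expressible L phi.
Proof.
move=> phi GNphi.
have Ktop := absorbable_top hGFO hsubst handor hcraig.
(* The identity renaming, the empty block and trivial conjuncts give back [phi] up to
   equivalence. *)
have Ephi := GNFO_absorbable hGFO hsubst handor hcraig GNphi id Ktop
  [::] (guarded_conj_top L).
apply: (expressible_equivalent Ephi) => [M v /=|R].
  by rewrite sat_rename; tauto.
by rewrite /= !cats0 syms_rename.
Qed.
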